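(* There is a planar poset $P$ of height $2$ with $\operatorname{qn}(P)\geq 4$.
   Context: All posets are finite and nonempty. For elements $a,b$ of a poset $P$, write $a \prec b$ (a cover relation, or cover) if $a<b$ and there is no $c\in P$ with $a<c<b$. The height of $P$ is the maximum number of pairwise comparable elements. A linear extension $L$ of $P$ is a linear order on the elements of $P$ such that $x<_L y$ whenever $x<_P y$. A rainbow of size $k$ (a $k$-rainbow) with respect to $L$ is a set of $k$ covers $a_1\prec b_1,\dots,a_k\prec b_k$ of $P$ with $a_1<_L\cdots<_L a_k<_L b_k<_L\cdots<_L b_1$. The queue-number $\operatorname{qn}(P)$ is the smallest $k$ such that there is a linear extension $L$ of $P$ with respect to which the covers of $P$ contain no $(k+1)$-rainbow. A diagram of $P$ represents the elements as distinct points in the plane and each cover $a\prec b$ as a $y$-monotone curve going upwards from $a$ to $b$ (not passing through points of other elements). A poset is planar if it admits a crossing-free diagram, i.e. one in which distinct curves meet only in common endpoints. *)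

(* Defs.v *)
From HB Require Import structures.
From mathcomp Require Import all_boot all_order all_algebra.
From mathcomp Require Import all_classical all_reals all_analysis.
Set Implicit Arguments.
Unset Strict Implicit.
Unset Printing Implicit Defensive.
Import Order.TTheory GRing.Theory Num.Theory.
Import numFieldNormedType.Exports.

Section Posets.
Local Open Scope order_scope.
Context {d : Order.disp_t} (P : finPOrderType d).
Implicit Types (a b x y : P) (L : rel P) (s : seq (P * P)) (k : nat).

Definition covers a b : bool := (a < b) && ~~ [exists c : P, a < c < b].

Definition is_chain (A : {set P}) : bool :=
  [forall x in A, forall y in A, x >=< y].

Definition height : nat := \max_(A : {set P} | is_chain A) #|A|.

(* [L] is the strict order <_L. *)
Definition linear_extension L : Prop :=
  [/\ irreflexive L, transitive L,
      forall x y, x != y -> L x y || L y x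
    & forall x y, x < y -> L x y].

(* [s] lists the covers (a_1, b_1), ..., (a_k, b_k), outermost first; the
   second clause reads a_1 <_L ... <_L a_k <_L b_k <_L ... <_L b_1. *)
Definition rainbow L s : bool :=
  all (fun e => covers e.1 e.2) s && sorted L (unzip1 s ++ rev (unzip2 s)).

Definition queue_layout k : Prop :=
  exists2 L : rel P, linear_extension L
    & ~ exists2 s : seq (P * P), rainbow L s & size s = k.+1.

Lemma exists_linear_extension : exists L : rel P, linear_extension L.
Proof.
pose h x := #|[set y : P | y < x]|.
pose L x y := (h x < h y)%N || ((h x == h y) && (enum_rank x < enum_rank y)%N).
exists L; split.
- by move=> x; rewrite /L !ltnn andbF.
- move=> y x z /orP[xy|/andP[/eqP xy rxy]] /orP[yz|/andP[/eqP yz ryz]].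
  + by rewrite /L (ltn_trans xy yz).
  + by rewrite /L -yz xy.
  + by rewrite /L xy yz.
  + by rewrite /L xy yz eqxx (ltn_trans rxy ryz) orbT.
- move=> x y xy; rewrite /L; case: (ltngtP (h x) (h y)) => //= _.
  by rewrite -neq_ltn; apply: contra_neq xy => /val_inj/enum_rank_inj.
- move=> x y xy; rewrite /L; apply/orP; left; apply: proper_card.
  apply/properP; split; last by exists x; rewrite !inE ?xy ?ltxx.
  by apply/fintype.subsetP => z; rewrite !inE => zx; apply: lt_trans xy.
Qed.

Lemma exists_queue_layout : exists k, `[< queue_layout k >].
Proof.
have [L LP] := exists_linear_extension; have [Lirr Ltr _ _] := LP.
exists #|P|; apply/asboolP; exists L => // -[s /andP[_ sL] sz].
have /card_uniqP us := sorted_uniq Ltr Lirr sL.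
have := max_card (mem (unzip1 s ++ rev (unzip2 s))).
by rewrite us size_cat size_map sz addSn ltnNge leq_addr.
Qed.

Definition queue_number : nat := ex_minn exists_queue_layout.

End Posets.

Section Planarity.
Local Open Scope classical_set_scope.
Local Open Scope ring_scope.
Context (R : realType) {d : Order.disp_t} (P : finPOrderType d).
Implicit Types (p : P -> R * R) (g : P -> P -> R -> R * R).

(* The curve of a cover (a, b) is parametrized by [g a b] on [0, 1]; the values
   of [g] elsewhere are irrelevant. *)
Definition is_diagram p g : Prop :=
  injective p /\
  forall a b : P, covers a b ->
    [/\ {within `[0, 1], continuous (g a b)},
        g a b 0 = p a, g a b 1 = p b,
        {in `[0, 1] &, {homo (fun t => (g a b t).2) : t u / t < u}}
      & forall t (c : P), t \in `[0, 1] -> g a b t = p c -> c = a \/ c = b].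

Definition crossing_free p g : Prop :=
  forall a b a' b' : P, covers a b -> covers a' b' -> (a, b) <> (a', b') ->
  forall t u, t \in `[0, 1] -> u \in `[0, 1] -> g a b t = g a' b' u ->
  exists c : P, [/\ c \in [:: a; b], c \in [:: a'; b'] & g a b t = p c].

Definition planar : Prop :=
  exists p g, is_diagram p g /\ crossing_free p g.

End Planarity.

(* Main.v *)
Require Import Defs.
From HB Require Import structures.
From mathcomp Require Import all_boot all_order all_algebra.
From mathcomp Require Import all_classical all_reals all_analysis.
From mathcomp Require Import zify ring lra.

Set Implicit Arguments.
Unset Strict Implicit.
Unset Printing Implicit Defensive.
Import Order.TTheory GRing.Theory Num.Theory.
Import numFieldNormedType.Exports.

(** The poset is a planar bipartite graph, ordered from one side to the other:
    two minima, the poles, lie below all of ten maxima, the tips, and tips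
    [2k], [2k+1] (a block, [k < 5]) have four further common lower neighbours.

    In a linear extension, let [u] be the earlier pole and [v] the later one.
    The two earliest and the two latest tips meet at most four of the five
    blocks, so some block, with tips [l] before [h], has tips [x0], [x1] before
    it and [y0], [y1] after it (lemma [middle_block]). Of its four inner minima,
    two, [c] before [c'], are in the same position relative to the poles
    (lemma [inner_pigeonhole]). The covers [c h] and [c' l] are nested, and two
    covers from the poles extend them to a 4-rainbow (lemma [nested_rainbow]):
    - [c, c', u, v, x0, x1, l, h]    gives  [c h, c' l, u x1, v x0];
    - [u, c, c', v, x1, l, h, y0]    gives  [u y0, c h, c' l, v x1];
    - [u, v, c, c', l, h, y0, y1]    gives  [u y1, v y0, c h, c' l].

    For planarity, the tips are put on the vertical axis and the poles at
    [(-1, 0)] and [(1, 0)]. Two consecutive tips and the left pole span a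
    triangle, and the inner minima of a block are put on the segment from the
    left pole to the midpoint of the two tips. All covers are drawn straight.
    In the coordinate [w = |x|], a cover ending at height [h] is the graph of
    [h (1 - w) + w r / 2] over an interval [0 <= w <= 1 / (1 + |r|)], where
    [r = 0] at the poles and [|r| = j + 1] at the [j]-th inner minimum
    (lemma [segmentE]). This common form makes the absence of crossings a
    single linear computation (lemmas [levels_apart], [segments_meet]). *)

(** * Posets of height two from bipartite graphs *)

Section TwoLevel.
Context (A B : finType).

(** The relation is a parameter of the type so that the order, which depends
    on it, can be inferred from the type. *)
Definition two_level (r : A -> B -> bool) : Type := (A + B)%type.

Context (r : A -> B -> bool).

HB.instance Definition _ := Finite.on (two_level r).

Definition two_level_lt (x y : two_level r) : bool :=
  match x, y with inl a, inr b => r a b | _, _ => false end.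

Fact two_level_lt_irr : irreflexive two_level_lt.
Proof. by case. Qed.

Fact two_level_lt_trans : transitive two_level_lt.
Proof. by move=> [?|?] [?|?] [?|?]. Qed.

Fact two_level_display : Order.disp_t. Proof. exact: Order.Disp tt tt. Qed.

HB.instance Definition _ := Order.Lt_isPOrder.Build two_level_display (two_level r)
  two_level_lt_irr two_level_lt_trans.

Lemma two_level_ltE (x y : two_level r) : (x < y)%O = two_level_lt x y.
Proof. by []. Qed.

Lemma two_level_covers (x y : two_level r) : covers x y = two_level_lt x y.
Proof.
rewrite /covers two_level_ltE andb_idr // => xy.
apply/existsP => -[z]; rewrite !two_level_ltE.
by case: x y z xy => [?|?] [?|?] [?|?] //=; rewrite andbF.
Qed.

Lemma two_level_height a b : r a b -> height (two_level r) = 2.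
Proof.
move=> rab; apply/eqP; rewrite eqn_leq; apply/andP; split.
  apply/bigmax_leqP => S /forall_inP chS.
  pose side (x : two_level r) := if x is inl _ then true else false.
  rewrite -card_bool; apply: (@leq_card_in _ _ side) => x y xS yS.
  have /forall_inP/(_ y yS) := chS x xS.
  rewrite /Order.comparable !le_eqVlt !two_level_ltE.
  by case: x y {xS yS} => [a1|b1] [a2|b2] //=;
     rewrite !orbF => /orP[] /eqP.
pose S : {set two_level r} := [set inl a; inr b].
have -> : 2 = #|S| by rewrite cards2.
apply: leq_bigmax_cond; apply/forall_inP => x xS; apply/forall_inP => y yS.
rewrite /Order.comparable !le_eqVlt !two_level_ltE.
by move: xS yS; rewrite !inE => /orP[] /eqP -> /orP[] /eqP ->;
   rewrite ?eqxx /= ?rab ?orbT.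
Qed.

End TwoLevel.

(** * Rainbows and queue-number *)

Section Rainbows.
Context {d : Order.disp_t} (P : finPOrderType d).

Lemma rainbow_behead (L : rel P) e s : rainbow L (e :: s) -> rainbow L s.
Proof.
case/andP=> /= /andP[_ cs] /path_sorted; rewrite rev_cons -rcons_cat -cats1.
by case/cat_sorted2=> ss _; rewrite /rainbow cs.
Qed.

Lemma rainbow_drop (L : rel P) n s : rainbow L s -> rainbow L (drop n s).
Proof.
elim: n s => [|n IHn] s; first by rewrite drop0.
by case: s => //= e s /rainbow_behead /IHn.
Qed.

(** A rainbow contains rainbows of all smaller sizes, so it refutes every
    smaller queue layout. *)
Lemma queue_number_geq k :
  (forall L : rel P, linear_extension L ->
     exists2 s : seq (P * P), rainbow L s & size s = k) ->
  k <= queue_number P.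
Proof.
move=> Hk; rewrite /queue_number; case: ex_minnP => m /asboolP[L LP noR] _.
rewrite leqNgt; apply/negP => lt_mk; apply: noR.
have [s sR sz] := Hk L LP; exists (drop (k - m.+1) s).
  exact: rainbow_drop.
by rewrite size_drop sz subKn.
Qed.

End Rainbows.

Section Extremes.
Context {T : finType} (L : rel T).
Hypotheses (Lirr : irreflexive L) (Ltr : transitive L)
  (Ltot : forall x y, x != y -> L x y || L y x).

Lemma strict_order_extremes : 4 <= #|T| ->
  exists x0 x1 y0 y1 : T, [/\ L x0 x1, L y0 y1 &
    forall z, z \notin [:: x0; x1; y0; y1] -> L x1 z && L z y0].
Proof.
pose le x y := (x == y) || L x y.
have le_tot : total le.
  by move=> x y; rewrite /le (eq_sym y); case: eqVneq => //= /Ltot.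
have le_tr : transitive le.
  move=> y x z /orP[/eqP->//|xy] /orP[/eqP<-|yz]; first by rewrite /le xy orbT.
  by rewrite /le (Ltr xy yz) orbT.
pose s := sort le (enum T).
have us : uniq s by rewrite sort_uniq enum_uniq.
have s_all z : z \in s by rewrite mem_sort mem_enum.
have Ls : pairwise L s.
  have : pairwise le s by rewrite -sorted_pairwise // sort_sorted.
  elim: s us {s_all} => //= x s IHs /andP[xs us] /andP[lexs /(IHs us)->].
  rewrite andbT; apply/allP => z zs; have := allP lexs z zs.
  by case/orP=> // /eqP xz; rewrite xz zs in xs.
have sz : size s = #|T| by rewrite size_sort cardE.
rewrite -sz; case: {sz} s Ls s_all {us} => [|x0 [|x1 s]] //.
case/lastP: s => // s y1; case/lastP: s => // s y0 Ls s_all _.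
exists x0, x1, y0, y1; move: Ls; rewrite /= !pairwise_rcons !all_rcons /=.
case/and3P => /and4P[x01 _ _ _] /and3P[_ _ x1s] /andP[/andP[y01 _]].
move=> /andP[sy0 _]; split=> // z; rewrite !inE !negb_or => /and4P[z0 z1 z2 z3].
have := s_all z; rewrite !(inE, mem_rcons).
rewrite (negPf z0) (negPf z1) (negPf z2) (negPf z3) /= => zs.
by rewrite (allP x1s) // (allP sy0).
Qed.

End Extremes.

(** * The poset *)

Definition bottom : Type := (bool + 'I_5 * 'I_4)%type.
HB.instance Definition _ := Finite.on bottom.

(** The two poles with the ten tips form a [K_{2,10}]; each block of two
    consecutive tips forms a [K_{2,4}] with its four inner minima, which is to
    be drawn inside one face of the [K_{2,10}]. *)
Definition below (m : bottom) (i : 'I_10) : bool :=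
  match m with inl _ => true | inr (k, _) => i./2 == k end.

Definition nested_poset := two_level below.
HB.instance Definition _ := Order.FinPOrder.on nested_poset.

Definition pole (e : bool) : nested_poset := inl (inl e).
Definition inner (k : 'I_5) (j : 'I_4) : nested_poset := inl (inr (k, j)).
Definition tip (i : 'I_10) : nested_poset := inr i.

(** * Every linear extension has a 4-rainbow *)

Section QueueNumber.
Context (L : rel nested_poset).
Hypothesis LP : linear_extension L.

Let Lirr : irreflexive L. Proof. by case: LP. Qed.
Let Ltr : transitive L. Proof. by case: LP. Qed.
Let Ltot x y : x != y -> L x y || L y x. Proof. by case: LP => _ _ + _; apply. Qed.

Lemma L_pole_tip e i : L (pole e) (tip i).
Proof. by case: LP => _ _ _; apply; rewrite two_level_ltE. Qed.

Lemma L_inner_tip (k : 'I_5) j (i : 'I_10) : i./2 = k -> L (inner k j) (tip i).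
Proof. by move=> ik; case: LP => _ _ _; apply; rewrite two_level_ltE /= ik. Qed.

(** Four tips cannot meet all five blocks, so some block avoids the two
    earliest tips [x0], [x1] and the two latest tips [y0], [y1]. *)
Lemma middle_block : exists (k : 'I_5) (x0 x1 y0 y1 : 'I_10),
  [/\ L (tip x0) (tip x1), L (tip y0) (tip y1) &
    forall i : 'I_10, i./2 = k -> L (tip x1) (tip i) && L (tip i) (tip y0)].
Proof.
pose Ltip (i j : 'I_10) := L (tip i) (tip j).
have tip_tot i j : i != j -> Ltip i j || Ltip j i.
  by move=> ij; apply: Ltot; apply: contra ij => /eqP[->].
have [x0 [x1 [y0 [y1 [x01 y01 mid]]]]] : exists x0 x1 y0 y1 : 'I_10,
    [/\ Ltip x0 x1, Ltip y0 y1 &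
      forall z, z \notin [:: x0; x1; y0; y1] -> Ltip x1 z && Ltip z y0].
  apply: strict_order_extremes => //; last by rewrite card_ord.
  by move=> j i k; exact: (@Ltr (tip j) (tip i) (tip k)).
have [k kP] : exists k : 'I_5, val k \notin map (fun i : 'I_10 => i./2) [:: x0; x1; y0; y1].
  apply/existsP; apply: contraT; rewrite negb_exists => /forallP bad.
  suff /uniq_leq_size : {subset map val (enum 'I_5) <=
      map (fun i : 'I_10 => i./2) [:: x0; x1; y0; y1]}.
    by rewrite size_map size_enum_ord map_inj_uniq ?enum_uniq; [apply|exact: val_inj].
  by move=> _ /mapP[k _ ->]; have := bad k; rewrite negbK.
exists k, x0, x1, y0, y1; split=> // i ik; apply: mid.
by apply: contra kP => /(map_f (fun i : 'I_10 => i./2)); rewrite ik.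
Qed.

(** The poles cut a linear extension into three parts, and four minima are
    distributed over them. *)
Lemma inner_pigeonhole e k : L (pole e) (pole (~~ e)) -> exists j1 j2 : 'I_4,
  L (inner k j1) (inner k j2) /\
  [\/ L (inner k j2) (pole e),
      L (pole e) (inner k j1) && L (inner k j2) (pole (~~ e))
    | L (pole (~~ e)) (inner k j1)].
Proof.
move=> Lpoles; pose u := pole e; pose v := pole (~~ e).
(* As [u] comes before [v], the number of poles before an inner minimum tells
   which part contains it. *)
pose pos (j : 'I_4) := L u (inner k j) + L v (inner k j).
have [j1 [j2 [j12 eq_pos]]] : exists j1 j2, j1 != j2 /\ pos j1 = pos j2.
  have pos_lt3 j : pos j < 3 by rewrite /pos; do 2!case: (L _ _).
  pose cls j : 'I_3 := inord (pos j).
  have /injectivePn[j1 [j2 j12 /(congr1 val)]] : ~~ injectiveb cls.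
    by apply/injectiveP => /leq_card; rewrite !card_ord.
  by rewrite /= !inordK // => eq_pos; exists j1, j2.
have uc j : L (inner k j) u = ~~ L u (inner k j).
  have /orP[uj|uj] := @Ltot u (inner k j) isT; rewrite uj.
    by apply/negP => /(Ltr uj); rewrite Lirr.
  by apply/esym/negP => /(Ltr uj); rewrite Lirr.
have vc j : L (inner k j) v = ~~ L v (inner k j).
  have /orP[uj|uj] := @Ltot v (inner k j) isT; rewrite uj.
    by apply/negP => /(Ltr uj); rewrite Lirr.
  by apply/esym/negP => /(Ltr uj); rewrite Lirr.
have uv j : L v (inner k j) -> L u (inner k j) by apply: Ltr.
wlog cc : j1 j2 {j12} eq_pos / L (inner k j1) (inner k j2).
  move=> W; have : inner k j1 != inner k j2 by apply: contra j12 => /eqP[->].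
  by case/Ltot/orP => [/W|/W]; apply.
exists j1, j2; split=> //; rewrite -/u -/v uc vc.
move: eq_pos (uv j1) (uv j2); rewrite /pos.
move: (L u (inner k j1)) (L v (inner k j1)) (L u (inner k j2)) (L v (inner k j2)).
move=> [] [] [] [] //= _ H1 H2; try by [constructor 1|constructor 2|constructor 3].
Qed.

(** The covers [c h] and [c' l] are nested for any two inner minima [c] before
    [c'] of a block; how two covers from the poles fit around or inside them
    depends on the part that contains [c] and [c']. *)
Lemma nested_rainbow : exists2 s : seq (nested_poset * nested_poset),
  rainbow L s & size s = 4.
Proof.
have [e Le] : exists e, L (pole e) (pole (~~ e)).
  by have /orP[] := @Ltot (pole true) (pole false) isT; [exists true|exists false].
have [k [x0 [x1 [y0 [y1 [x01 y01 mid]]]]]] := middle_block.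
have [l [h [lk hk Llh]]] : exists l h : 'I_10,
    [/\ l./2 = k, h./2 = k & L (tip l) (tip h)].
  have k5 := ltn_ord k; pose i1 : 'I_10 := inord k.*2; pose i2 : 'I_10 := inord k.*2.+1.
  have v1 : i1 = k.*2 :> nat by rewrite inordK; lia.
  have v2 : i2 = k.*2.+1 :> nat by rewrite inordK; lia.
  have h1 : i1./2 = k by rewrite v1; lia.
  have h2 : i2./2 = k by rewrite v2; lia.
  have /Ltot/orP[] : tip i1 != tip i2.
    by apply/eqP => -[] /(congr1 val) /=; rewrite v1 v2; lia.
  - by exists i1, i2.
  - by exists i2, i1.
have [x1l _] := andP (mid l lk); have [_ hy0] := andP (mid h hk).
have [j1 [j2 [Lc cases]]] := @inner_pigeonhole e k Le.
have cl := L_inner_tip j2 lk; have px := L_pole_tip (~~ e).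
case: cases => [cu|/andP[uc cv]|vc].
- exists [:: (inner k j1, tip h); (inner k j2, tip l);
             (pole e, tip x1); (pole (~~ e), tip x0)] => //.
  rewrite /rainbow /= !two_level_covers /= hk lk !eqxx /=.
  by rewrite Lc cu Le px x01 x1l Llh.
- exists [:: (pole e, tip y0); (inner k j1, tip h); (inner k j2, tip l);
             (pole (~~ e), tip x1)] => //.
  rewrite /rainbow /= !two_level_covers /= hk lk !eqxx /=.
  by rewrite uc Lc cv px x1l Llh hy0.
- exists [:: (pole e, tip y1); (pole (~~ e), tip y0); (inner k j1, tip h);
             (inner k j2, tip l)] => //.
  rewrite /rainbow /= !two_level_covers /= hk lk !eqxx /=.
  by rewrite Le vc Lc cl Llh hy0 y01.
Qed.

End QueueNumber.

(** * A crossing-free drawing *)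

Section Drawing.
Local Open Scope classical_set_scope.
Local Open Scope ring_scope.
Context (R : realType).

(** The offset 3 makes the drawing upward: the inner minima are at most 4/5 of
    the way up to the midpoint of their block, and [4/5 (h + 1/2) < h] only for
    [h > 2]. *)
Definition level (i : 'I_10) : R := (i + 3)%:R.

Definition place (x : nested_poset) : R * R :=
  match x with
  | inl (inl e) => ((-1) ^+ e, 0)
  | inl (inr (k, j)) =>
      (- (j.+2%:R)^-1, j.+1%:R / j.+2%:R * ((k.*2 + 3)%:R + 2^-1))
  | inr i => (0, level i)
  end.

Definition segment (x y : nested_poset) (t : R) : R * R :=
  ((1 - t) * (place x).1 + t * (place y).1,
   (1 - t) * (place x).2 + t * (place y).2).

Definition side (m : bottom) : R := if m is inl e then (-1) ^+ e else -1.

(** Half of it is the offset, at the scale [w = 1], of the cover from the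
    straight line towards a pole; the two tips of a block see an inner minimum
    under opposite offsets. *)
Definition tilt (m : bottom) (i : 'I_10) : R :=
  if m is inr (_, j) then (-1) ^+ odd i * j.+1%:R else 0.

Lemma norm_tilt m i :
  `|tilt m i| = if m is inr (_, j) then j.+1%:R else 0.
Proof.
by case: m => [e|[k j]] /=; rewrite ?normr0 // normrM normr_sign mul1r ger0_norm.
Qed.

Lemma half_eqE (k i : nat) : i./2 = k -> i = (odd i + k.*2)%N.
Proof. by move=> <-; rewrite odd_double_half. Qed.

(** A common form of all covers, in which [w] is the distance to the vertical
    axis. *)
Lemma segmentE m (i : 'I_10) t : below m i ->
  let w := (1 - t) / (1 + `|tilt m i|) in
  segment (inl m) (inr i) t = (side m * w, level i * (1 - w) + w * tilt m i / 2).
Proof.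
rewrite norm_tilt; case: m => [e|[k j]]; rewrite /segment /= /level.
  by move=> _; congr pair; field.
move=> /eqP/half_eqE ->; rewrite oddD odd_double addbF oddb.
have j0 : 0 <= j%:R :> R by [].
rewrite !natrD -!(natr1 j.+1) -!(natr1 j).
case: (odd i) => /=; rewrite ?expr0 ?expr1.
  by congr pair; field; rewrite ?andbT; lra.
by congr pair; field; rewrite ?andbT; lra.
Qed.

Lemma segment0 x y : segment x y 0 = place x.
Proof. by rewrite /segment !subr0 !mul1r !mul0r !addr0 -surjective_pairing. Qed.

Lemma segment1 x y : segment x y 1 = place y.
Proof. by rewrite /segment !subrr !mul1r !mul0r !add0r -surjective_pairing. Qed.

Lemma place_inj : injective place.
Proof.
have neg (j : nat) : - (j.+2%:R)^-1 != (0 : R) by rewrite oppr_eq0 invr_eq0 pnatr_eq0.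
have sgn (e : bool) : (-1) ^+ e != 0 :> R by rewrite signr_eq0.
have small (j : nat) (e : bool) : - (j.+2%:R)^-1 != (-1) ^+ e :> R.
  apply/eqP => /(congr1 (fun z : R => `|z|)); rewrite normr_sign normrN ger0_norm //.
  by move/eqP; rewrite invr_eq1 pnatr_eq1.
move=> [[e|[k j]]|i] [[e'|[k' j']]|i'] //=.
- by case=> /signr_inj ->.
- by case=> /esym/eqP; rewrite (negPf (small _ _)).
- by case=> /eqP; rewrite (negPf (sgn _)).
- by case=> /eqP; rewrite (negPf (small _ _)).
- case=> /oppr_inj/invr_inj/eqP; rewrite eqr_nat => /eqP [jj].
  rewrite jj => /mulfI; rewrite mulf_neq0 ?invr_eq0 ?pnatr_eq0 // => /(_ isT).
  move/addIr/eqP; rewrite eqr_nat eqn_add2r => /eqP/double_inj kk.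
  by congr (inl (inr _)); congr pair; apply: val_inj.
- by case=> /eqP; rewrite (negPf (neg _)).
- by case=> /esym/eqP; rewrite (negPf (sgn _)).
- by case=> /esym/eqP; rewrite (negPf (neg _)).
- by case=> /eqP; rewrite eqr_nat eqn_add2r => /eqP/val_inj ->.
Qed.

Lemma segment_rises m (i : 'I_10) : below m i ->
  (place (inl m)).2 < (place (inr i)).2.
Proof.
case: m => [e|[k j]] /=; first by rewrite /level ltr0n addn_gt0 orbT.
move=> /eqP/half_eqE ik; rewrite /level.
have j4 : j.+2%:R <= 5 :> R by rewrite ler_nat; have := ltn_ord j.
have ki : (k.*2 + 3)%:R <= (i + 3)%:R :> R.
  by rewrite ler_nat leq_add2r ik leq_addl.
have k0 : 3 <= (k.*2 + 3)%:R :> R by rewrite ler_nat leq_addl.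
apply: lt_le_trans ki; have j0 : 0 < j.+2%:R :> R by [].
rewrite mulrAC ltr_pdivrMr // -(natr1 j.+1); rewrite -(natr1 j.+1) in j4.
nra.
Qed.

(** Seen from tips at heights [h] and [h'] at least 1 apart, the lines towards
    a pole are [(h' - h) (1 - w) >= 1 - w] apart, while the two covers leave
    them by at most [w |r| / 2] and [w |r'| / 2], each at most [(1 - w) / 2].
    Hence they meet only if both bounds are attained, at their lower ends. *)
Lemma levels_apart (h h' w r r' : R) : h + 1 <= h' -> 0 <= w ->
  w * (1 + `|r|) <= 1 -> w * (1 + `|r'|) <= 1 ->
  h * (1 - w) + w * r / 2 = h' * (1 - w) + w * r' / 2 ->
  w * (1 + `|r|) = 1 /\ w * (1 + `|r'|) = 1.
Proof.
move=> hh' w0 wr wr' eqy.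
have r0 : 0 <= w * `|r| by rewrite mulr_ge0.
have gap : 0 <= (h' - h - 1) * (1 - w) by apply: mulr_ge0; lra.
have rle : w * r <= w * `|r| by rewrite ler_wpM2l // ler_norm.
have rge : - (w * r') <= w * `|r'| by rewrite -mulrN ler_wpM2l // -normrN ler_norm.
split; lra.
Qed.

Lemma tilt_inj m m' i : below m i -> below m' i ->
  side m = side m' -> tilt m i = tilt m' i -> m = m'.
Proof.
have sgn : (-1) ^+ odd i != 0 :> R by rewrite signr_eq0.
case: m m' => [e|[k j]] [e'|[k' j']] //=.
- by move=> _ _ /signr_inj ->.
- by move=> _ _ _ /esym/eqP; rewrite mulf_eq0 (negPf sgn) pnatr_eq0.
- by move=> _ _ _ /eqP; rewrite mulf_eq0 (negPf sgn) pnatr_eq0.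
move=> /eqP ik /eqP; rewrite ik => /val_inj -> _ /(mulfI sgn)/eqP.
by rewrite eqr_nat => /eqP[] /val_inj ->.
Qed.

(** Covers with the same tip leave it in different directions, by [tilt_inj];
    covers with different tips can only meet at their lower ends, by
    [levels_apart]. The left and the right half plane share only [w = 0]. *)
Lemma segments_meet m i m' i' t u :
  below m i -> below m' i' -> 0 <= t <= 1 -> 0 <= u <= 1 ->
  segment (inl m) (inr i) t = segment (inl m') (inr i') u ->
  [\/ m = m' /\ i = i', i = i' /\ t = 1 | [/\ m = m', t = 0 & u = 0]].
Proof.
move=> mi mi' /andP[t0 t1] /andP[u0 u1] meet; have := meet.
rewrite !segmentE //=; set r := tilt m i; set r' := tilt m' i'.
have n0 : 0 < 1 + `|r| by have := normr_ge0 r; lra.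
have n0' : 0 < 1 + `|r'| by have := normr_ge0 r'; lra.
set w := (1 - t) / _; set w' := (1 - u) / _.
have wE : w * (1 + `|r|) = 1 - t by rewrite divfK // gt_eqF.
have wE' : w' * (1 + `|r'|) = 1 - u by rewrite divfK // gt_eqF.
have w0 : 0 <= w by rewrite divr_ge0 ?subr_ge0 // ltW.
have w0' : 0 <= w' by rewrite divr_ge0 ?subr_ge0 // ltW.
have norm_side m0 : `|side m0| = 1.
  by case: m0 => [e|?] /=; rewrite ?normr_sign // normrN1.
case=> eqx; have ww' : w' = w.
  move/(congr1 (fun z : R => `|z|)): eqx; clearbody w w'.
  by rewrite !normrM !norm_side !mul1r !ger0_norm.
rewrite ww' in wE' eqx * => eqy.
have tails : w * (1 + `|r|) = 1 /\ w * (1 + `|r'|) = 1 ->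
    [/\ m = m', t = 0 & u = 0].
  move=> [e e']; have [t00 u00] : t = 0 /\ u = 0 by split; lra.
  by move: meet; rewrite t00 u00 !segment0 => /place_inj[->].
have w1 : w * (1 + `|r|) <= 1 by lra.
have w1' : w * (1 + `|r'|) <= 1 by lra.
have next (a b : 'I_10) : (a < b)%N -> level a + 1 <= level b.
  by rewrite /level natr1 ler_nat -addSn leq_add2r.
have [ii|ii|/val_inj ii] := ltngtP i i'.
- by constructor 3; apply/tails/(levels_apart (next _ _ ii)).
- constructor 3; apply/tails.
  by have [] := levels_apart (next _ _ ii) w0 w1' w1 (esym eqy).
have [wz|wn0] := eqVneq w 0.
  by constructor 2; split=> //; move: wE; rewrite wz mul0r; lra.
constructor 1; split=> //; subst i'; apply: (tilt_inj mi mi').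
  exact: (mulIf wn0).
by apply: (mulfI wn0); rewrite -/r -/r'; lra.
Qed.

Lemma segment_continuous x y : continuous (segment x y).
Proof.
have aff (a b : R) : continuous (fun t : R => (1 - t) * a + t * b).
  move=> t; apply: cvgD; apply: cvgM; try exact: cvg_cst; last exact: cvg_id.
  by apply: cvgB; [exact: cvg_cst|exact: cvg_id].
by move=> t; exact: cvg_pair (aff _ _ t) (aff _ _ t).
Qed.

Lemma nested_crossing_free : crossing_free place segment.
Proof.
move=> [m|?] [?|i] [m'|?] [?|i']; rewrite !two_level_covers //= => mi mi' ne t u.
rewrite !in_itv /= => t01 u01 /[dup] eqg /(segments_meet mi mi' t01 u01).
case=> [[e1 e2]|[<- ->]|[<- -> _]].
- by case: ne; rewrite e1 e2.
- by exists (inr i); rewrite segment1 !inE !eqxx !orbT.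
- by exists (inl m); rewrite segment0 !inE !eqxx.
Qed.

Lemma nested_diagram : is_diagram place segment.
Proof.
split; first exact: place_inj.
move=> x y xy; split; rewrite ?segment0 ?segment1 //.
- by apply: continuous_subspaceT; apply: segment_continuous.
- move: x y xy => [m|?] [?|i]; rewrite two_level_covers //= => mi t u _ _ tu.
  have rise := segment_rises mi; rewrite /segment /= -subr_gt0.
  have : 0 < (u - t) * ((place (inr i)).2 - (place (inl m)).2).
    by rewrite mulr_gt0 ?subr_gt0.
  by move=> /=; lra.
(* Every element [c] is an end of some cover, so a curve through [c] meets the
   curve of that cover. *)
move=> t c t01 gc.
have [a [b [ab cab]]] : exists a b : nested_poset,
    covers a b /\ c \in [:: a; b].
  case: c {gc} => [[e|[k j]]|i].
  - by exists (pole e), (tip ord0); rewrite two_level_covers inE eqxx.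
  - exists (inner k j), (tip (inord k.*2)); rewrite two_level_covers inE eqxx /=.
    by rewrite inordK ?doubleK //; have := ltn_ord k; lia.
  - by exists (pole true), (tip i); rewrite two_level_covers !inE eqxx orbT.
have [[<- <-]|ne] := pselect ((a, b) = (x, y)).
  by move: cab; rewrite !inE => /orP[]/eqP; [left|right].
have [u u01 uc] : exists2 u : R, u \in `[0, 1] & segment a b u = place c.
  move: cab; rewrite !inE => /orP[]/eqP ->.
    by exists 0; rewrite ?segment0 // in_itv /= lexx ler01.
  by exists 1; rewrite ?segment1 // in_itv /= lexx ler01.
have ne' : (x, y) <> (a, b) by move=> e; apply: ne.
have [c' [c'xy _]] := nested_crossing_free xy ab ne' t01 u01 (etrans gc (esym uc)).
rewrite gc => /place_inj ->; move: c'xy.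
by rewrite !inE => /orP[]/eqP; [left|right].
Qed.

End Drawing.

Theorem theorem3 (R : realType) :
  exists (d : Order.disp_t) (P : finPOrderType d),
    [/\ planar R P, height P = 2 & 4 <= queue_number P].
Proof.
exists two_level_display, nested_poset; split.
- by exists (@place R), (@segment R); split;
    [exact: nested_diagram|exact: nested_crossing_free].
- exact: (@two_level_height _ _ below (inl true) ord0).
- by apply: queue_number_geq => L /nested_rainbow.
Qed.
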